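(* Let $B,\alpha_+,\beta_+,\gamma_+,\delta_+,\beta_-,\gamma_-$ be real numbers with $B>\delta_+>0$, and let $I:[0,b[\to\mathbb R$ be the slow divergence integral defined in the context. If $$\big(\beta_-\ne 0 \text{ and } (\alpha_+,\gamma_-)\ne(0,0)\big)\quad\text{or}\quad\big(\beta_-=0 \text{ and } \alpha_++\gamma_-(B-\delta_+)\ne 0\big),$$ then $I$ has at most $1$ zero, counting multiplicity, in $]0,b[$. Moreover, there exist parameter values $(\beta_-,\gamma_-,B,\alpha_+,\delta_+)$ satisfying this condition for which $I$ has a simple zero in $]0,b[$. If the condition is not satisfied, then $I$ is identically zero.
   Context: Consider the planar affine vector fields $Z^-(x,y)=(-1+\beta_- y,\,-x+\gamma_- y)$ and $Z^+(x,y)=(B+\alpha_+x+\beta_+y,\,\delta_+x+\gamma_+y)$, with $B>\delta_+>0$ ($Z^+$ acts in $y>0$, $Z^-$ in $y<0$, discontinuity line $y=0$). Let $X^{sl}(u)=\frac{1}{1+\delta_+}(B-\delta_++\alpha_+u)$ (the Filippov sliding vector field on $y=0$). Poincaré half-map $\Pi$: for $x>0$ the forward orbit of $Z^-$ through $(x,0)$ enters $\{y<0\}$; when it returns to $\{y=0\}$, its first return point is $(\Pi(x),0)$ with $\Pi(x)<0$; set $\Pi(0)=0$. The domain of $\Pi$ is the set of $x\ge 0$ where it is defined (an interval containing $0$). Let $\phi:\mathbb R\to\mathbb R$ be a smooth function with $\phi'>0$, $\phi(s)\to 1$ as $s\to+\infty$, $\phi(s)\to0$ as $s\to-\infty$.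 The slow divergence integral is $$I(x)=(1+\delta_+)\,\phi'\!\Big(\phi^{-1}\big(\tfrac{1}{1+\delta_+}\big)\Big)\int_{\Pi(x)}^{x}\frac{u\,du}{X^{sl}(u)},$$ defined on $[0,b[$ ($b>0$ or $b=+\infty$), the largest interval of the form $[0,b[$ contained in the domain of $\Pi$ such that $X^{sl}>0$ on $[\Pi(x),x]$ for every $x\in[0,b[$. *)

(* Defs.v *)
From Stdlib Require Import Reals ClassicalEpsilon.
From Coquelicot Require Import Coquelicot.
Open Scope R_scope.

Definition Xsl (B ap dp u : R) : R := (B - dp + ap * u) / (1 + dp).

(* [half_return bm gm x u]: the forward orbit of
   Z^-(x,y) = (-1 + bm y, -x + gm y) through (x,0) stays in {y<0} on ]0,T[
   and first returns to {y = 0} at time T > 0 at the point (u,0).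
   Orbits of the affine field Z^- exist for all times, so the orbit is
   given by a curve (p,q) : R -> R^2 solving the ODE everywhere. *)
Definition half_return (bm gm x u : R) : Prop :=
  exists T : R, 0 < T /\
  exists p q : R -> R,
    (forall t, is_derive p t (-1 + bm * q t)) /\
    (forall t, is_derive q t (- p t + gm * q t)) /\
    p 0 = x /\ q 0 = 0 /\
    (forall t, 0 < t < T -> q t < 0) /\
    q T = 0 /\ p T = u.

Definition Pi_dom (bm gm x : R) : Prop :=
  x = 0 \/ (0 < x /\ exists u, half_return bm gm x u).

(* The Poincare half-map (the returning point is unique by uniqueness of
   solutions of the ODE; we pick it by choice). *)
Definition Pi (bm gm x : R) : R :=
  match Req_EM_T x 0 with
  | left _ => 0
  | right _ => epsilon (inhabits 0) (fun u => half_return bm gm x u)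
  end.

Definition good (B ap dp bm gm x : R) : Prop :=
  Pi_dom bm gm x /\
  (forall u, Pi bm gm x <= u <= x -> 0 < Xsl B ap dp u).

(* Membership in [0,b[, the union of all intervals [0,c[ consisting of
   admissible points (i.e. the largest such interval). *)
Definition in_I_dom (B ap dp bm gm x : R) : Prop :=
  0 <= x /\ exists c, x < c /\ (forall y, 0 <= y < c -> good B ap dp bm gm y).

(* phi^{-1}(y) (phi is strictly increasing, so the preimage is unique). *)
Definition phi_inv (phi : R -> R) (y : R) : R :=
  epsilon (inhabits 0) (fun s => phi s = y).

Definition admissible_phi (phi : R -> R) : Prop :=
  (forall n x, ex_derive_n phi n x) /\
  (forall x, 0 < Derive phi x) /\
  is_lim phi p_infty 1 /\ is_lim phi m_infty 0.

Definition SDI (phi : R -> R) (B ap dp bm gm x : R) : R :=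
  (1 + dp) * Derive phi (phi_inv phi (/ (1 + dp)))
  * RInt (fun u => u / Xsl B ap dp u) (Pi bm gm x) x.

Definition cond (B ap dp bm gm : R) : Prop :=
  (bm <> 0 /\ (ap <> 0 \/ gm <> 0)) \/
  (bm = 0 /\ ap + gm * (B - dp) <> 0).

(* Main.v *)
Require Import Defs.
From Stdlib Require Import Reals Ranalysis5 Lra ClassicalEpsilon.
From Coquelicot Require Import Coquelicot.
Open Scope R_scope.

(** Write [W(s) = bm s^2 - gm s + 1] and [c0 = B - dp]. Projecting an orbit of [Z^-] from the
    equilibrium onto [y = 0] gives [s = (p - gm q) / (1 - bm q)], which satisfies the scalar
    equation [s' = - W(s)], while [D = 1 - bm q] satisfies [D' = bm s D]. Hence a half-return from
    [x] to [u] forces [W > 0] on [[u, x]] and [int_u^x s / W(s) ds = 0]; this determines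
    [u = Pi x], makes [Pi] differentiable, and shows that [x + Pi x] has the sign of [- gm].
    The derivative of the slow divergence integral is then a positive factor times
    [G = c0 bm (x + Pi) - c0 gm + ap bm x Pi - ap], and at a zero of [G] one has
    [G' = bm (c0 + ap Pi) (x + Pi) / Pi], of constant sign. So [G] vanishes at most once, and
    Rolle's theorem, starting from the zero at [x = 0], gives the bound. For the example take
    [bm = -2], [gm = 1], where [Pi (2/7) = - 5/14], and choose [ap] by the intermediate value
    theorem. *)

(** * Mean value and Rolle arguments on the real line *)

Lemma mvt_open (f df : R -> R) (a b : R) : a < b ->
  (forall x, a <= x <= b -> is_derive f x (df x)) ->
  exists c, a < c < b /\ f b - f a = df c * (b - a).
Proof.
  intros Hab Hf.
  destruct (MVT_cor2 f df a b Hab) as [c [Hc1 Hc2]].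
  - intros c Hc. apply is_derive_Reals. now apply Hf.
  - exists c. now split.
Qed.

Lemma derive_pos_lt (f df : R -> R) (a b : R) : a < b ->
  (forall x, a <= x <= b -> is_derive f x (df x)) ->
  (forall x, a < x < b -> 0 < df x) -> f a < f b.
Proof.
  intros Hab Hf Hp.
  destruct (mvt_open f df a b Hab Hf) as [c [Hc E]].
  specialize (Hp c Hc).
  assert (0 < df c * (b - a)) by (apply Rmult_lt_0_compat; lra). lra.
Qed.

Lemma derive_zero_eq (f : R -> R) (a b : R) :
  (forall x, is_derive f x 0) -> f a = f b.
Proof.
  intros Hf.
  destruct (Rtotal_order a b) as [H|[H|H]].
  - destruct (mvt_open f (fun _ => 0) a b H) as [c [_ E]].
    + intros; apply Hf.
    + lra.
  - now subst.
  - destruct (mvt_open f (fun _ => 0) b a H) as [c [_ E]].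
    + intros; apply Hf.
    + lra.
Qed.

Lemma derive_eq (f : R -> R) (x l l' : R) : is_derive f x l -> l = l' -> is_derive f x l'.
Proof. intros H <-. exact H. Qed.

Lemma is_derive_continuity_pt (f : R -> R) (x l : R) : is_derive f x l -> continuity_pt f x.
Proof.
  intros H. apply continuity_pt_filterlim. apply (ex_derive_continuous f x).
  now exists l.
Qed.

Lemma continuity_pt_eps (f : R -> R) (x : R) : continuity_pt f x ->
  forall e, 0 < e -> exists d, 0 < d /\ forall y, Rabs (y - x) < d -> Rabs (f y - f x) < e.
Proof.
  intros H e He. destruct (H e He) as [d [Hd K]]. exists d. split; [exact Hd|].
  intros y Hy. destruct (Req_dec x y) as [<-|Hne].
  - rewrite Rminus_diag, Rabs_R0. exact He.
  - apply K. split; [split; [exact I|exact Hne]|exact Hy].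
Qed.

Lemma continuity_pt_pos (f : R -> R) (x : R) : continuity_pt f x -> 0 < f x ->
  exists d, 0 < d /\ forall y, Rabs (y - x) < d -> 0 < f y.
Proof.
  intros H Hp. destruct (continuity_pt_eps f x H (f x) Hp) as [d [Hd K]].
  exists d. split; [exact Hd|]. intros y Hy. specialize (K y Hy).
  apply Rabs_def2 in K. lra.
Qed.

(* The first zero after [a] would be reached from above, against the sign of the derivative. *)
Lemma no_return_to_zero (f : R -> R) (a b : R) : a < b -> 0 < f a -> f b = 0 ->
  (forall x, a <= x <= b -> continuity_pt f x) ->
  (forall x, a <= x <= b -> f x = 0 -> exists l, is_derive f x l /\ 0 < l) -> False.
Proof.
  intros Hab Ha Hb Hc Hd.
  set (E := fun t => a <= t <= b /\ forall s, a <= s <= t -> 0 < f s).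
  assert (HEa : E a).
  { split; [lra|]. intros s Hs. replace s with a by lra. exact Ha. }
  destruct (completeness E) as [z [Hub Hlub]].
  - exists b. intros t [Ht _]. lra.
  - now exists a.
  - assert (Haz : a <= z) by now apply Hub.
    assert (Hzb : z <= b) by (apply Hlub; intros t [Ht _]; lra).
    assert (Hbefore : forall s, a <= s < z -> 0 < f s).
    { intros s Hs. destruct (Rlt_dec 0 (f s)) as [|Hn]; [assumption|exfalso].
      assert (z <= s); [|lra]. apply Hlub. intros t [Ht Hp].
      destruct (Rle_dec t s) as [|Hts]; [assumption|exfalso].
      apply Hn, Hp. lra. }
    (* [z] is the supremum of [E]. A negative [f z] contradicts continuity from the left, a zero is
       excluded by the derivative, and a positive value would extend [E] beyond [z]. *)
    destruct (Rtotal_order (f z) 0) as [H|[H|H]].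
    + assert (a < z) by (destruct Haz as [|Haz]; [assumption|subst; lra]).
      destruct (continuity_pt_pos (fun t => - f t) z) as [d [Hdp K]].
      * apply continuity_pt_opp, Hc. lra.
      * lra.
      * set (s := Rmax a (z - d / 2)).
        assert (a <= s < z /\ Rabs (s - z) < d) as [Hs1 Hs2].
        { unfold s, Rmax. destruct (Rle_dec a (z - d / 2));
            (split; [lra|rewrite Rabs_left; lra]). }
        specialize (K s Hs2). specialize (Hbefore s Hs1). lra.
    + assert (a < z) by (destruct Haz as [|Haz]; [assumption|subst; lra]).
      destruct (Hd z (conj Haz Hzb) H) as [l [Hl Hlp]].
      apply is_derive_Reals in Hl.
      destruct (Hl l Hlp) as [d K].
      pose proof (cond_pos d) as Hdp.
      set (s := Rmax a (z - d / 2)).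
      assert (a <= s < z /\ Rabs (s - z) < d) as [Hs1 Hs2].
      { unfold s, Rmax. destruct (Rle_dec a (z - d / 2));
          (split; [lra|rewrite Rabs_left; lra]). }
      assert (Hne : s - z <> 0) by lra.
      specialize (K (s - z) Hne Hs2).
      replace (z + (s - z)) with s in K by ring. rewrite H in K.
      specialize (Hbefore s Hs1).
      apply Rabs_def2 in K.
      assert (0 < (f s - 0) / (s - z)) by lra.
      assert (0 < ((f s - 0) / (s - z)) * (z - s)) by (apply Rmult_lt_0_compat; lra).
      replace (((f s - 0) / (s - z)) * (z - s)) with (- f s) in H2 by (field; lra). lra.
    + assert (z < b) by (destruct Hzb as [|Hzb]; [assumption|subst; lra]).
      destruct (continuity_pt_pos f z) as [d [Hdp K]]; [apply Hc; lra|lra|].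
      assert (E (Rmin b (z + d / 2))).
      { split; [unfold Rmin; destruct (Rle_dec b (z + d / 2)); lra|].
        intros s Hs. destruct (Rlt_dec s z); [apply Hbefore; lra|].
        apply K. rewrite Rabs_pos_eq by lra.
        pose proof (Rmin_r b (z + d / 2)). lra. }
      apply Hub in H1. unfold Rmin in H1. destruct (Rle_dec b (z + d / 2)); lra.
Qed.

(** Just after a zero [f] is positive, and [no_return_to_zero] then forbids another. The sign of the
    derivative is asked at zeros only, where [dG_at_zero] supplies it. *)
Lemma increasing_zero_unique (f df : R -> R) (c : R) :
  (forall x, 0 < x < c -> is_derive f x (df x)) ->
  (forall x, 0 < x < c -> f x = 0 -> 0 < df x) ->
  forall x y, 0 < x < c -> 0 < y < c -> f x = 0 -> f y = 0 -> x = y.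
Proof.
  intros Hd Hp.
  assert (K : forall x y, 0 < x < c -> 0 < y < c -> f x = 0 -> f y = 0 -> ~ x < y).
  { intros x y Hx Hy Ex Ey Hxy.
    pose proof (Hd x Hx) as Hl. apply is_derive_Reals in Hl.
    pose proof (Hp x Hx Ex) as Hlp.
    destruct (Hl (df x) Hlp) as [d K]. pose proof (cond_pos d) as Hdp.
    set (h := Rmin (d / 2) ((y - x) / 2)).
    assert (Hh : 0 < h < y - x /\ h < d).
    { unfold h, Rmin. destruct (Rle_dec (d / 2) ((y - x) / 2)); lra. }
    assert (Hh0 : h <> 0) by lra.
    assert (Hhd : Rabs h < d) by (rewrite Rabs_pos_eq; lra).
    specialize (K h Hh0 Hhd). rewrite Ex in K. apply Rabs_def2 in K.
    assert (Hfp : 0 < f (x + h)).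
    { replace (f (x + h)) with (((f (x + h) - 0) / h) * h) by (field; lra).
      apply Rmult_lt_0_compat; lra. }
    apply (no_return_to_zero f (x + h) y); try lra.
    - intros z Hz. apply is_derive_continuity_pt with (df z). apply Hd. lra.
    - intros z Hz Ez. exists (df z). split; [apply Hd; lra|apply Hp; lra]. }
  intros x y Hx Hy Ex Ey. destruct (Rtotal_order x y) as [H|[H|H]]; [|exact H|].
  - now destruct (K x y Hx Hy Ex Ey).
  - now destruct (K y x Hy Hx Ey Ex).
Qed.

(** A one-sided limit stands in for the value at [0], since the slow divergence integral is
    differentiated for [x > 0] only. The function [g], equal to [0] on the left, reduces this to the
    usual theorem. *)
Lemma rolle_from_zero (f df : R -> R) (b : R) : 0 < b ->
  (forall x, 0 < x <= b -> is_derive f x (df x)) ->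
  (forall e, 0 < e -> exists d, 0 < d /\ forall x, 0 < x < d -> Rabs (f x) < e) ->
  f b = 0 -> exists c, 0 < c < b /\ df c = 0.
Proof.
  intros Hb Hd H0 Eb.
  set (g := fun x => if Rle_dec x 0 then 0 else f x).
  assert (Hg : forall x, 0 < x <= b -> is_derive g x (df x)).
  { intros x Hx. apply (is_derive_ext_loc f); [|now apply Hd].
    exists (mkposreal x (proj1 Hx)). intros y Hy.
    apply Rabs_def2 in Hy. unfold minus, plus, opp in Hy; simpl in Hy.
    unfold g. destruct (Rle_dec y 0); [lra|reflexivity]. }
  assert (Hg0 : forall x, x <= 0 -> g x = 0).
  { intros x Hx. unfold g. destruct (Rle_dec x 0); [reflexivity|lra]. }
  assert (Hgp : forall x, 0 < x -> g x = f x).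
  { intros x Hx. unfold g. destruct (Rle_dec x 0); [lra|reflexivity]. }
  assert (Hc : forall x, 0 <= x <= b -> continuity_pt g x).
  { intros x Hx. destruct (Req_dec x 0) as [->|].
    - intros e He. destruct (H0 e He) as [d [Hdp K]]. exists d. split; [exact Hdp|].
      intros y [_ Hy]. simpl in *. unfold Rdist in *.
      rewrite (Hg0 0) by lra. rewrite !Rminus_0_r in *.
      destruct (Rle_dec y 0) as [Hy0|Hy0].
      + rewrite (Hg0 y Hy0), Rabs_R0. exact He.
      + rewrite Hgp by lra. apply K. apply Rabs_def2 in Hy. lra.
    - apply is_derive_continuity_pt with (df x). apply Hg. lra. }
  assert (pr : forall x, 0 < x < b -> derivable_pt g x).
  { intros x Hx. exists (df x). apply is_derive_Reals, Hg. lra. }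
  destruct (Rolle g 0 b pr Hc Hb) as [c [P E]].
  - rewrite (Hg0 0), Hgp by lra. now rewrite Eb.
  - exists c. split; [exact P|].
    rewrite <- E. symmetry. apply derive_pt_eq_0. apply is_derive_Reals, Hg. lra.
Qed.

(** * The primitive of [s / w s] that vanishes at the origin *)

(** Keeps the zeros of [w] off the segment of integration of [prim], for either sign of [u]. *)
Definition pos_to (w : R -> R) (u : R) : Prop :=
  forall s, Rmin 0 u <= s <= Rmax 0 u -> 0 < w s.

(** Serves twice: with [w = Wq bm gm] it characterises the half-map, with [w = Xsl B ap dp] it gives
    the slow divergence integral. *)
Definition prim (w : R -> R) (u : R) : R := RInt (fun s => s / w s) 0 u.

Lemma pos_to_between (w : R -> R) (u v : R) :
  (0 <= v <= u \/ u <= v <= 0) -> pos_to w u -> pos_to w v.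
Proof.
  intros H Hu s Hs. apply Hu. revert Hs. unfold Rmin, Rmax.
  destruct (Rle_dec 0 v), (Rle_dec 0 u); lra.
Qed.

Lemma pos_to_end (w : R -> R) (u : R) : pos_to w u -> 0 < w u.
Proof. intros H. apply H. split; [apply Rmin_r|apply Rmax_r]. Qed.

(** A point of the segment to [v] lies on the segment to [u] or within [|v - u|] of [u], where
    continuity of [w] takes over. *)
Lemma pos_to_open (w : R -> R) (u : R) : continuity w -> pos_to w u ->
  exists d, 0 < d /\ forall v, Rabs (v - u) < d -> pos_to w v.
Proof.
  intros Hw Hu.
  destruct (continuity_pt_pos w u (Hw u) (pos_to_end w u Hu)) as [d [Hd K]].
  exists d. split; [exact Hd|]. intros v Hv s Hs.
  destruct (Rle_dec (Rmin 0 u) s) as [H1|H1]; [destruct (Rle_dec s (Rmax 0 u)) as [H2|H2]|].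
  - apply Hu. lra.
  - apply K. apply Rabs_def2 in Hv. apply Rabs_def1; revert Hs H1 H2; unfold Rmin, Rmax;
      destruct (Rle_dec 0 v), (Rle_dec 0 u); lra.
  - apply K. apply Rabs_def2 in Hv. apply Rabs_def1; revert Hs H1; unfold Rmin, Rmax;
      destruct (Rle_dec 0 v), (Rle_dec 0 u); lra.
Qed.

Lemma continuous_id_div (w : R -> R) (s : R) : continuity w -> 0 < w s ->
  continuous (fun s => s / w s) s.
Proof.
  intros Hw Hs. apply continuity_pt_filterlim. apply continuity_pt_div.
  - apply derivable_continuous_pt, derivable_pt_id.
  - apply Hw.
  - lra.
Qed.

Lemma ex_RInt_prim (w : R -> R) (u : R) : continuity w -> pos_to w u ->
  ex_RInt (fun s => s / w s) 0 u.
Proof.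
  intros Hw Hu. apply (ex_RInt_continuous (V := R_CompleteNormedModule)).
  intros s Hs. apply continuous_id_div; [exact Hw|now apply Hu].
Qed.

Lemma is_derive_prim (w : R -> R) (u : R) : continuity w -> pos_to w u ->
  is_derive (prim w) u (u / w u).
Proof.
  intros Hw Hu. apply (is_derive_RInt (V := R_NormedModule) (fun s => s / w s) (prim w) 0 u).
  - destruct (pos_to_open w u Hw Hu) as [d [Hd K]].
    exists (mkposreal d Hd). intros v Hv.
    apply (RInt_correct (V := R_CompleteNormedModule)). apply ex_RInt_prim; [exact Hw|]. now apply K.
  - apply continuous_id_div; [exact Hw|now apply pos_to_end].
Qed.

Lemma prim_zero (w : R -> R) : prim w 0 = 0.
Proof. unfold prim. now rewrite RInt_point. Qed.

Lemma RInt_prim (w : R -> R) (u v : R) : continuity w -> pos_to w u -> pos_to w v ->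
  RInt (fun s => s / w s) u v = prim w v - prim w u.
Proof.
  intros Hw Hu Hv.
  assert (E : prim w u + RInt (fun s => s / w s) u v = prim w v).
  { apply (RInt_Chasles (V := R_CompleteNormedModule) (fun s => s / w s) 0 u v).
    - now apply ex_RInt_prim.
    - apply ex_RInt_Chasles with 0; [apply ex_RInt_swap|]; now apply ex_RInt_prim. }
  rewrite <- E. symmetry. apply Rplus_minus_l.
Qed.

(** The integrand has the sign of [s], so [prim w] grows away from [0] on either side; [prim_decr]
    is the other half. *)
Lemma prim_incr (w : R -> R) (u v : R) : continuity w -> pos_to w v ->
  0 <= u < v -> prim w u < prim w v.
Proof.
  intros Hw Hv H. apply derive_pos_lt with (fun s => s / w s); [lra| |].
  - intros s Hs. apply is_derive_prim; [exact Hw|]. apply pos_to_between with v; [lra|exact Hv].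
  - intros s Hs. apply Rdiv_lt_0_compat; [lra|]. apply pos_to_end.
    apply pos_to_between with v; [lra|exact Hv].
Qed.

Lemma prim_decr (w : R -> R) (u v : R) : continuity w -> pos_to w u ->
  u < v <= 0 -> prim w v < prim w u.
Proof.
  intros Hw Hu H. apply Ropp_lt_cancel.
  apply (derive_pos_lt (fun s => - prim w s) (fun s => - (s / w s)) u v); [lra| |].
  - intros s Hs. apply (is_derive_opp (V := R_NormedModule) (prim w)). apply is_derive_prim; [exact Hw|].
    apply pos_to_between with u; [lra|exact Hu].
  - intros s Hs. replace (- (s / w s)) with ((- s) / w s) by (unfold Rdiv; ring).
    apply Rdiv_lt_0_compat; [lra|]. apply pos_to_end.
    apply pos_to_between with u; [lra|exact Hu].
Qed.

(* [W(x) = V(x, 0)], where [V = D^2 - gm N D + bm N^2], with [N = p - gm q] and [D = 1 - bm q], has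
   [V' = gm V] along [Z^-] (an inverse integrating factor). *)
Definition Wq (bm gm s : R) : R := bm * s ^ 2 - gm * s + 1.

Lemma Wq_continuity (bm gm : R) : continuity (Wq bm gm).
Proof.
  intros s. apply is_derive_continuity_pt with (2 * bm * s - gm).
  unfold Wq. auto_derive; [exact I|ring].
Qed.

(** * Orbits of [Z^-] and their projection to the line [y = 0] *)

Section Orbit.
Variables (bm gm : R) (p q : R -> R).
Hypothesis Hp : forall t, is_derive p t (-1 + bm * q t).
Hypothesis Hq : forall t, is_derive q t (- p t + gm * q t).

Let N t := p t - gm * q t.
Let D t := 1 - bm * q t.
Let V t := D t ^ 2 - gm * N t * D t + bm * N t ^ 2.

Lemma orbit_N_derive t : is_derive N t (gm * N t - D t).
Proof.
  unfold N, D. auto_derive.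
  - repeat split; [exists (-1 + bm * q t); apply Hp|exists (- p t + gm * q t); apply Hq].
  - rewrite (is_derive_unique (fun y : R => p y) _ _ (Hp t)),
      (is_derive_unique (fun y : R => q y) _ _ (Hq t)). ring.
Qed.

Lemma orbit_D_derive t : is_derive D t (bm * N t).
Proof.
  unfold N, D. auto_derive.
  - exists (- p t + gm * q t); apply Hq.
  - rewrite (is_derive_unique (fun y : R => q y) _ _ (Hq t)). ring.
Qed.

Lemma orbit_V_exp t : V t = V 0 * exp (gm * t).
Proof.
  assert (E : V t * exp (- gm * t) = V 0 * exp (- gm * 0)).
  { apply (derive_zero_eq (fun t => V t * exp (- gm * t))). intros x. unfold V. auto_derive.
    - repeat split;
        solve [exists (bm * N x); apply orbit_D_derive|exists (gm * N x - D x); apply orbit_N_derive].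
    - rewrite (is_derive_unique (fun y : R => N y) _ _ (orbit_N_derive x)),
        (is_derive_unique (fun y : R => D y) _ _ (orbit_D_derive x)). ring. }
  rewrite Rmult_0_r, exp_0, Rmult_1_r in E. rewrite <- E, Rmult_assoc, <- exp_plus.
  replace (- gm * t + gm * t) with 0 by ring. rewrite exp_0. ring.
Qed.

Lemma orbit_V_pos_transfer t t' : 0 < V t -> 0 < V t'.
Proof.
  rewrite (orbit_V_exp t), (orbit_V_exp t'). intros H.
  assert (0 < V 0) by (apply (Rmult_lt_reg_r (exp (gm * t))); [apply exp_pos|lra]).
  apply Rmult_lt_0_compat; [assumption|apply exp_pos].
Qed.

(* Gronwall for [N^2 + D^2], which is positive at time [0]. *)
Lemma orbit_not_equilibrium t : q 0 = 0 -> 0 < t -> N t = 0 -> D t = 0 -> False.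
Proof.
  intros Hq0 Ht HN HD.
  (* The derivative of [N^2 + D^2] is [2 gm N^2 + 2 (bm - 1) N D], which is at least
     [- k (N^2 + D^2)]. *)
  set (k := 2 * Rabs gm + Rabs (bm - 1) + 1).
  assert (E : (N 0 ^ 2 + D 0 ^ 2) * exp (k * 0) <= (N t ^ 2 + D t ^ 2) * exp (k * t)).
  { destruct (mvt_open (fun s => (N s ^ 2 + D s ^ 2) * exp (k * s))
      (fun s => (2 * N s * (gm * N s - D s) + 2 * D s * (bm * N s) + k * (N s ^ 2 + D s ^ 2))
                * exp (k * s)) 0 t Ht) as [c [Hc E]].
    - intros x _. auto_derive.
      + repeat split;
          solve [exists (bm * N x); apply orbit_D_derive|exists (gm * N x - D x); apply orbit_N_derive].
      + rewrite (is_derive_unique (fun y : R => N y) _ _ (orbit_N_derive x)),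
          (is_derive_unique (fun y : R => D y) _ _ (orbit_D_derive x)). ring.
    - assert (K : 0 <= 2 * N c * (gm * N c - D c) + 2 * D c * (bm * N c) + k * (N c ^ 2 + D c ^ 2)).
      { unfold k. pose proof (Rle_abs gm). pose proof (Rle_abs (- gm)).
        pose proof (Rle_abs (bm - 1)). pose proof (Rle_abs (- (bm - 1))).
        rewrite (Rabs_Ropp gm), (Rabs_Ropp (bm - 1)) in *.
        set (g := Rabs gm) in *. set (a := Rabs (bm - 1)) in *.
        replace (2 * N c * (gm * N c - D c) + 2 * D c * (bm * N c) + (2 * g + a + 1) * (N c ^ 2 + D c ^ 2))
          with (2 * (gm + g) * N c ^ 2 + 2 * g * D c ^ 2 + N c ^ 2 + D c ^ 2 +
            ((a + (bm - 1)) * (N c + D c) ^ 2 + (a - (bm - 1)) * (N c - D c) ^ 2) / 2) by field.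
        pose proof (pow2_ge_0 (N c)). pose proof (pow2_ge_0 (D c)).
        pose proof (pow2_ge_0 (N c + D c)). pose proof (pow2_ge_0 (N c - D c)).
        assert (0 <= 2 * (gm + g) * N c ^ 2) by (apply Rmult_le_pos; lra).
        assert (0 <= 2 * g * D c ^ 2) by (apply Rmult_le_pos; lra).
        assert (0 <= (a + (bm - 1)) * (N c + D c) ^ 2) by (apply Rmult_le_pos; lra).
        assert (0 <= (a - (bm - 1)) * (N c - D c) ^ 2) by (apply Rmult_le_pos; lra).
        lra. }
      pose proof (exp_pos (k * c)).
      assert (0 <= (2 * N c * (gm * N c - D c) + 2 * D c * (bm * N c) + k * (N c ^ 2 + D c ^ 2))
                * exp (k * c) * (t - 0)) by (repeat apply Rmult_le_pos; lra).
      lra. }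
  rewrite HN, HD, Rmult_0_r, exp_0 in E. unfold D in E. rewrite Hq0 in E.
  pose proof (pow2_ge_0 (N 0)). lra.
Qed.

Variable T : R.
Hypothesis HT : 0 < T.
Hypothesis Hq0 : q 0 = 0.
Hypothesis HqT : q T = 0.
Hypothesis Hneg : forall t, 0 < t < T -> q t < 0.

Lemma orbit_N_vanishes : exists c, 0 < c < T /\ N c = 0.
Proof.
  destruct (mvt_open q (fun t => - p t + gm * q t) 0 T HT) as [c [Hc E]].
  { intros; apply Hq. }
  exists c. split; [exact Hc|]. unfold N. rewrite Hq0, HqT in E.
  assert (K : (- p c + gm * q c) * T = 0) by lra.
  apply Rmult_integral in K. lra.
Qed.

(* By Rolle [q' = - N] vanishes at some time, where [V = D^2]. *)
Lemma orbit_V_pos t : 0 < V t.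
Proof.
  destruct orbit_N_vanishes as [c [Hc HN]].
  apply (orbit_V_pos_transfer c). unfold V. rewrite HN.
  assert (HD : D c <> 0) by (intros HD; apply (orbit_not_equilibrium c); tauto || lra).
  replace (D c ^ 2 - gm * 0 * D c + bm * 0 ^ 2) with (D c ^ 2) by ring.
  now apply pow2_gt_0.
Qed.

Lemma orbit_D_continuity : continuity D.
Proof. intros t. apply is_derive_continuity_pt with (bm * N t). apply orbit_D_derive. Qed.

(** For [0 <= bm], [q <= 0] gives [D >= 1]. For [bm < 0], a zero of [D] would make
    [V = bm N^2 <= 0]. *)
Lemma orbit_D_pos t : 0 <= t <= T -> 0 < D t.
Proof.
  intros Ht.
  assert (Hq' : q t <= 0).
  { destruct (Req_dec t 0) as [->|]; [lra|]. destruct (Req_dec t T) as [->|]; [lra|].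
    left. apply Hneg. lra. }
  destruct (Rle_lt_dec 0 bm) as [Hb|Hb].
  - unfold D. assert (0 <= bm * - q t) by (apply Rmult_le_pos; lra). lra.
  - destruct (Rlt_le_dec 0 (D t)) as [|HD]; [assumption|exfalso].
    assert (H0 : D 0 = 1) by (unfold D; rewrite Hq0; ring).
    destruct (IVT_cor D 0 t orbit_D_continuity) as [z [Hz Ez]]; [lra|nra|].
    pose proof (orbit_V_pos z) as HV. unfold V in HV. rewrite Ez in HV.
    pose proof (pow2_ge_0 (N z)). nra.
Qed.

Let s t := N t / D t.

Lemma orbit_s_derive t : 0 <= t <= T -> is_derive s t (- Wq bm gm (s t)).
Proof.
  intros Ht. pose proof (orbit_D_pos t Ht). unfold s, Wq. auto_derive.
  - repeat split; [exists (gm * N t - D t); apply orbit_N_derive|exists (bm * N t); apply orbit_D_derive|lra].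
  - rewrite (is_derive_unique (fun y : R => N y) _ _ (orbit_N_derive t)),
      (is_derive_unique (fun y : R => D y) _ _ (orbit_D_derive t)).
    field. lra.
Qed.

Lemma orbit_W_pos t : 0 <= t <= T -> 0 < Wq bm gm (s t).
Proof.
  intros Ht. pose proof (orbit_D_pos t Ht). pose proof (orbit_V_pos t).
  replace (Wq bm gm (s t)) with (V t / D t ^ 2).
  - apply Rdiv_lt_0_compat; [assumption|]. now apply pow_lt.
  - unfold Wq, V, s. field. lra.
Qed.

Lemma orbit_s_zero : s 0 = p 0.
Proof. unfold s, N, D. rewrite Hq0. field. Qed.

Lemma orbit_s_return : s T = p T.
Proof. unfold s, N, D. rewrite HqT. field. Qed.

Lemma orbit_s_decr a b : 0 <= a -> a < b -> b <= T -> s b < s a.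
Proof.
  intros Ha Hab Hb. apply Ropp_lt_cancel.
  apply (derive_pos_lt (fun t => - s t) (fun t => Wq bm gm (s t)) a b Hab).
  - intros t Ht. apply derive_eq with (- - Wq bm gm (s t)); [|ring].
    apply (is_derive_opp (V := R_NormedModule) s). apply orbit_s_derive. lra.
  - intros t Ht. apply orbit_W_pos. lra.
Qed.

(** [s] is strictly decreasing, ends at [p T], and vanishes earlier together with [N]. *)
Lemma orbit_end_neg : p T < 0.
Proof.
  destruct orbit_N_vanishes as [c [Hc HN]].
  replace 0 with (s c) by (unfold s; rewrite HN; unfold Rdiv; ring).
  rewrite <- orbit_s_return. apply orbit_s_decr; lra.
Qed.

(** Transfers what is known along the orbit to every point of [[p T, p 0]]. *)
Lemma orbit_s_onto y : p T <= y <= p 0 -> exists t, 0 <= t <= T /\ s t = y.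
Proof.
  intros Hy. rewrite <- orbit_s_return, <- orbit_s_zero in Hy.
  destruct (Req_dec y (s 0)) as [->|H0]; [exists 0; split; [lra|reflexivity]|].
  destruct (Req_dec y (s T)) as [->|H1]; [exists T; split; [lra|reflexivity]|].
  destruct (IVT_interv (fun t => y - s t) 0 T) as [z [Hz Ez]]; try lra.
  - intros t Ht. apply is_derive_continuity_pt with (Wq bm gm (s t)).
    apply derive_eq with (0 - - Wq bm gm (s t)); [|ring].
    apply (is_derive_minus (V := R_NormedModule) (fun _ => y) s).
    + apply (is_derive_const (V := R_NormedModule)).
    + now apply orbit_s_derive.
  - exists z. split; [exact Hz|lra].
Qed.

Lemma half_return_W_pos y : p T <= y <= p 0 -> 0 < Wq bm gm y.
Proof. intros Hy. destruct (orbit_s_onto y Hy) as [t [Ht <-]]. now apply orbit_W_pos. Qed.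

(* [s' = - W(s)] and [D' = bm s D] make [bm * prim s + ln D] a first integral;
   for [bm = 0] its place is taken by [prim s - q]. *)
Lemma half_return_prim_eq (L : forall y, p T <= y <= p 0 -> pos_to (Wq bm gm) y) :
  prim (Wq bm gm) (p T) = prim (Wq bm gm) (p 0).
Proof.
  assert (Hs : forall t, 0 <= t <= T -> pos_to (Wq bm gm) (s t)).
  { intros t Ht. apply L. rewrite <- orbit_s_return, <- orbit_s_zero. split.
    - destruct (Req_dec t T) as [->|]; [lra|]. left. apply orbit_s_decr; lra.
    - destruct (Req_dec t 0) as [->|]; [lra|]. left. apply orbit_s_decr; lra. }
  assert (HF : forall t, 0 <= t <= T ->
    is_derive (fun t => prim (Wq bm gm) (s t)) t (- s t)).
  { intros t Ht. apply derive_eq with (- Wq bm gm (s t) * (s t / Wq bm gm (s t))).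
    - apply (is_derive_comp (V := R_NormedModule) (prim (Wq bm gm)) s).
      + apply is_derive_prim; [apply Wq_continuity|now apply Hs].
      + now apply orbit_s_derive.
    - field. pose proof (orbit_W_pos t Ht). lra. }
  rewrite <- orbit_s_return, <- orbit_s_zero.
  destruct (Req_dec bm 0) as [Hb|Hb].
  - destruct (mvt_open (fun t => prim (Wq bm gm) (s t) - q t) (fun _ => 0) 0 T HT) as [c [_ E]].
    + intros t Ht. apply derive_eq with (- s t - (- p t + gm * q t)).
      * apply (is_derive_minus (V := R_NormedModule) (fun t => prim (Wq bm gm) (s t)) q);
          [now apply HF|apply Hq].
      * unfold s, N, D. rewrite Hb. field.
    + lra.
  - destruct (mvt_open (fun t => bm * prim (Wq bm gm) (s t) + ln (D t)) (fun _ => 0) 0 T HT)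
      as [c [_ E]].
    + intros t Ht. pose proof (orbit_D_pos t Ht) as HD.
      apply derive_eq with (bm * - s t + bm * N t * / D t).
      * apply (is_derive_plus (V := R_NormedModule) (fun t => bm * prim (Wq bm gm) (s t))
          (fun t => ln (D t))).
        -- apply (is_derive_scal (fun t => prim (Wq bm gm) (s t))). now apply HF.
        -- apply (is_derive_comp (V := R_NormedModule) ln D); [|apply orbit_D_derive].
           now apply is_derive_ln.
      * unfold s. field. lra.
    + assert (HDT : D T = 1) by (unfold D; rewrite HqT; ring).
      assert (HD0 : D 0 = 1) by (unfold D; rewrite Hq0; ring).
      rewrite HDT, HD0 in E. apply (Rmult_eq_reg_l bm); [lra|exact Hb].
Qed.
End Orbit.

(** * The half-map as a relation between [x] and [u] *)

(** A half-return with the time eliminated: equality of the primitives says that the integral of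
    [s / w s] from [u] to [x] vanishes. *)
Definition paired (w : R -> R) (x u : R) : Prop :=
  u < 0 /\ pos_to w u /\ pos_to w x /\ prim w u = prim w x.

Lemma half_return_paired (bm gm x u : R) : 0 < x -> half_return bm gm x u ->
  paired (Wq bm gm) x u.
Proof.
  intros Hx (T & HT & p & q & Hp & Hq & Hp0 & Hq0 & Hn & HqT & HpT).
  assert (Hu : u < 0).
  { rewrite <- HpT. now apply (orbit_end_neg bm gm p q Hp Hq T). }
  assert (HW : forall y, u <= y <= x -> 0 < Wq bm gm y).
  { intros y Hy. apply (half_return_W_pos bm gm p q Hp Hq T HT Hq0 HqT Hn). now rewrite Hp0, HpT. }
  assert (L : forall y, u <= y <= x -> pos_to (Wq bm gm) y).
  { intros y Hy z Hz. apply HW. revert Hz. unfold Rmin, Rmax. destruct (Rle_dec 0 y); lra. }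
  split; [exact Hu|]. split; [apply L; lra|]. split; [apply L; lra|].
  rewrite <- Hp0, <- HpT.
  apply (half_return_prim_eq bm gm p q Hp Hq T HT Hq0 HqT Hn).
  rewrite Hp0, HpT. exact L.
Qed.

(** By [prim_decr], [prim w] is injective on the negative side; this pins down the point chosen in
    [Pi]. *)
Lemma paired_unique (w : R -> R) (x u v : R) : continuity w ->
  paired w x u -> paired w x v -> u = v.
Proof.
  intros Hw (Hu & Pu & _ & Eu) (Hv & Pv & _ & Ev).
  destruct (Rtotal_order u v) as [H|[H|H]]; [|exact H|].
  - pose proof (prim_decr w u v Hw Pu). lra.
  - pose proof (prim_decr w v u Hw Pv). lra.
Qed.

Lemma Pi_zero (bm gm : R) : Pi bm gm 0 = 0.
Proof. unfold Pi. destruct (Req_EM_T 0 0); [reflexivity|lra]. Qed.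

Lemma Pi_paired (bm gm x : R) : 0 < x -> Pi_dom bm gm x ->
  paired (Wq bm gm) x (Pi bm gm x).
Proof.
  intros Hx [->|[_ He]]; [lra|]. apply half_return_paired; [exact Hx|].
  unfold Pi. destruct (Req_EM_T x 0); [lra|]. now apply epsilon_spec.
Qed.

Lemma Pi_half_return (bm gm x u : R) : 0 < x -> half_return bm gm x u -> Pi bm gm x = u.
Proof.
  intros Hx H. apply paired_unique with (Wq bm gm) x; [apply Wq_continuity| |].
  - apply Pi_paired; [exact Hx|]. right. split; [exact Hx|now exists u].
  - now apply half_return_paired.
Qed.

(* As a function of [a], the difference has derivative [2 gm a^2 / (W(a) W(-a))]. *)
Lemma prim_odd_part (bm gm a : R) : 0 < a ->
  pos_to (Wq bm gm) a -> pos_to (Wq bm gm) (- a) ->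
  exists k, 0 < k /\ prim (Wq bm gm) a - prim (Wq bm gm) (- a) = k * gm.
Proof.
  intros Ha Pa Pm.
  assert (P1 : forall s, 0 <= s <= a -> pos_to (Wq bm gm) s).
  { intros s Hs. apply pos_to_between with a; [lra|exact Pa]. }
  assert (P2 : forall s, 0 <= s <= a -> pos_to (Wq bm gm) (- s)).
  { intros s Hs. apply pos_to_between with (- a); [lra|exact Pm]. }
  destruct (mvt_open (fun s => prim (Wq bm gm) s - prim (Wq bm gm) (- s))
    (fun s => 2 * s ^ 2 / (Wq bm gm s * Wq bm gm (- s)) * gm) 0 a Ha) as [c [Hc E]].
  - intros s Hs. pose proof (pos_to_end _ _ (P1 s Hs)) as W1.
    pose proof (pos_to_end _ _ (P2 s Hs)) as W2.
    apply derive_eq with (s / Wq bm gm s - (-1) * (- s / Wq bm gm (- s))).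
    + apply (is_derive_minus (V := R_NormedModule) (prim (Wq bm gm))
        (fun s => prim (Wq bm gm) (- s))).
      * apply is_derive_prim; [apply Wq_continuity|now apply P1].
      * apply (is_derive_comp (V := R_NormedModule) (prim (Wq bm gm)) Ropp).
        -- apply is_derive_prim; [apply Wq_continuity|now apply P2].
        -- auto_derive; [exact I|reflexivity].
    + replace (s / Wq bm gm s - -1 * (- s / Wq bm gm (- s))) with
        (s * (Wq bm gm (- s) - Wq bm gm s) / (Wq bm gm s * Wq bm gm (- s))) by (field; lra).
      replace (Wq bm gm (- s) - Wq bm gm s) with (2 * gm * s) by (unfold Wq; ring).
      field; lra.
  - assert (W1 := pos_to_end _ _ (P1 c ltac:(lra))).
    assert (W2 := pos_to_end _ _ (P2 c ltac:(lra))).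
    exists (2 * c ^ 2 / (Wq bm gm c * Wq bm gm (- c)) * a). split.
    + apply Rmult_lt_0_compat; [|exact Ha].
      apply Rdiv_lt_0_compat; [|now apply Rmult_lt_0_compat].
      assert (0 < c ^ 2) by (apply pow_lt; lra). lra.
    + rewrite Ropp_0 in E. lra.
Qed.

(** Compares [u] with [- x] through the monotone [prim]: by [prim_odd_part], the values of [prim] at
    opposite points differ by a positive multiple of [gm]. *)
Lemma paired_sum_sign (bm gm x u : R) : 0 < x -> paired (Wq bm gm) x u ->
  (0 < gm -> x + u < 0) /\ (gm < 0 -> 0 < x + u) /\ (gm = 0 -> x + u = 0).
Proof.
  intros Hx (Hu & Pu & Px & E).
  pose proof (Wq_continuity bm gm) as Hc.
  assert (HL : 0 <= gm -> x + u <= 0 /\ (0 < gm -> x + u < 0)).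
  { intros Hg.
    (* Since [W(- s) - W(s) = 2 gm s], positivity passes from [[0, x]] to its mirror image when
       [0 <= gm]. When [gm <= 0], it is [[u, 0]] that gets reflected. *)
    assert (Pm : pos_to (Wq bm gm) (- x)).
    { intros s Hs. assert (Hs' : - x <= s <= 0)
        by (revert Hs; unfold Rmin, Rmax; destruct (Rle_dec 0 (- x)); lra).
      assert (H : 0 < Wq bm gm (- s)).
      { apply Px. unfold Rmin, Rmax; destruct (Rle_dec 0 x); lra. }
      unfold Wq in *. assert (0 <= gm * - s) by (apply Rmult_le_pos; lra). lra. }
    destruct (prim_odd_part bm gm x Hx Px Pm) as [k [Hk Ek]].
    assert (0 <= k * gm) by (apply Rmult_le_pos; lra).
    split.
    - destruct (Rle_lt_dec (x + u) 0) as [|H1]; [assumption|].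
      pose proof (prim_decr _ (- x) u Hc Pm). lra.
    - intros Hg'. assert (0 < k * gm) by now apply Rmult_lt_0_compat.
      destruct (Rlt_le_dec (x + u) 0) as [|[H2|H2]]; [assumption| |].
      + pose proof (prim_decr _ (- x) u Hc Pm). lra.
      + replace u with (- x) in E by lra. lra. }
  assert (HR : gm <= 0 -> 0 <= x + u /\ (gm < 0 -> 0 < x + u)).
  { intros Hg.
    assert (Pm : pos_to (Wq bm gm) (- u)).
    { intros s Hs. assert (Hs' : 0 <= s <= - u)
        by (revert Hs; unfold Rmin, Rmax; destruct (Rle_dec 0 (- u)); lra).
      assert (H : 0 < Wq bm gm (- s)).
      { apply Pu. unfold Rmin, Rmax; destruct (Rle_dec 0 u); lra. }
      unfold Wq in *. assert (0 <= - gm * s) by (apply Rmult_le_pos; lra). lra. }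
    destruct (prim_odd_part bm gm (- u)) as [k [Hk Ek]]; [lra|exact Pm|now rewrite Ropp_involutive|].
    rewrite Ropp_involutive in Ek.
    assert (0 <= k * - gm) by (apply Rmult_le_pos; lra).
    split.
    - destruct (Rle_lt_dec 0 (x + u)) as [|H1]; [assumption|].
      pose proof (prim_incr _ x (- u) Hc Pm). lra.
    - intros Hg'. assert (0 < k * - gm) by (apply Rmult_lt_0_compat; lra).
      destruct (Rlt_le_dec 0 (x + u)) as [|[H2|H2]]; [assumption| |].
      + pose proof (prim_incr _ x (- u) Hc Pm). lra.
      + replace (- u) with x in Ek by lra. lra. }
  split; [intros; apply HL; lra|]. split; [intros; apply HR; lra|].
  intros Hg. destruct HL; [lra|]. destruct HR; lra.
Qed.

(** * Differentiability of the half-map *)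

(** Carathéodory's form of the derivative: the difference quotient completed by [l] at [x]. It
    composes without a case split on whether an increment is zero. *)
Definition slope (f : R -> R) (x l y : R) : R :=
  if Req_EM_T y x then l else (f y - f x) / (y - x).

Lemma slope_spec (f : R -> R) (x l y : R) : f y - f x = slope f x l y * (y - x).
Proof. unfold slope. destruct (Req_EM_T y x) as [->|]; [ring|field; lra]. Qed.

Lemma slope_at (f : R -> R) (x l : R) : slope f x l x = l.
Proof. unfold slope. now destruct (Req_EM_T x x). Qed.

Lemma slope_continuity (f : R -> R) (x l : R) : is_derive f x l ->
  continuity_pt (slope f x l) x.
Proof.
  intros H e He. apply is_derive_Reals in H. destruct (H e He) as [d K].
  exists d. split; [apply cond_pos|]. intros y [[_ Hne] Hy]. simpl in *. unfold Rdist in *.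
  rewrite slope_at. unfold slope. destruct (Req_EM_T y x); [congruence|].
  specialize (K (y - x) ltac:(lra) Hy). now replace (x + (y - x)) with y in K by ring.
Qed.

Lemma is_derive_caratheodory (f g : R -> R) (x d : R) : 0 < d -> continuity_pt g x ->
  (forall y, Rabs (y - x) < d -> f y - f x = g y * (y - x)) -> is_derive f x (g x).
Proof.
  intros Hd Hg H. apply is_derive_Reals. intros e He.
  destruct (continuity_pt_eps g x Hg e He) as [d' [Hd' K]].
  exists (mkposreal (Rmin d d') (Rmin_pos _ _ Hd Hd')). simpl. intros h Hh0 Hh.
  pose proof (Rmin_l d d'). pose proof (Rmin_r d d').
  assert (E : x + h - x = h) by ring.
  rewrite H by (rewrite E; lra). rewrite E.
  replace (g (x + h) * h / h) with (g (x + h)) by (field; lra).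
  apply K. rewrite E. lra.
Qed.

Section PairedMap.
Variables (w P : R -> R) (c : R).
Hypothesis Hw : continuity w.
Hypothesis HP : forall y, 0 < y < c -> paired w y (P y).

Lemma prim_continuity_pt u : pos_to w u -> continuity_pt (prim w) u.
Proof. intros H. apply is_derive_continuity_pt with (u / w u). now apply is_derive_prim. Qed.

(** [prim w] is strictly decreasing on the negative side, so its values at [P x - e'] and [P x + e']
    trap [P y] once [prim w y] is close to [prim w x]. *)
Lemma paired_continuity_pt x : 0 < x < c -> continuity_pt P x.
Proof.
  intros Hx e He. destruct (HP x Hx) as (Hu & Pu & Px & E).
  destruct (pos_to_open w (P x) Hw Pu) as [d0 [Hd0 K0]].
  (* Small enough that [w] stays positive up to [P x - e'] and that [P x + e'] is still negative. *)
  set (e' := Rmin (e / 2) (Rmin (d0 / 2) (- P x / 2))).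
  assert (He' : 0 < e' /\ e' < e /\ e' < d0 /\ e' < - P x).
  { unfold e', Rmin. destruct (Rle_dec (d0 / 2) (- P x / 2));
      destruct (Rle_dec (e / 2) _); lra. }
  assert (Pm : pos_to w (P x - e')).
  { apply K0. rewrite Rabs_left; lra. }
  pose proof (prim_decr w (P x - e') (P x) Hw Pm ltac:(lra)) as F1.
  pose proof (prim_decr w (P x) (P x + e') Hw Pu ltac:(lra)) as F2.
  set (r := Rmin (prim w (P x - e') - prim w (P x)) (prim w (P x) - prim w (P x + e'))).
  assert (Hr : 0 < r) by (apply Rmin_pos; lra).
  assert (Hr1 : r <= prim w (P x - e') - prim w (P x)) by apply Rmin_l.
  assert (Hr2 : r <= prim w (P x) - prim w (P x + e')) by apply Rmin_r.
  destruct (continuity_pt_eps (prim w) x (prim_continuity_pt x Px) r Hr) as [d1 [Hd1 K1]].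
  exists (Rmin d1 (Rmin x (c - x))). split; [repeat apply Rmin_pos; lra|].
  intros y [_ Hy]. simpl in *. unfold Rdist in *.
  pose proof (Rmin_l d1 (Rmin x (c - x))). pose proof (Rmin_r d1 (Rmin x (c - x))).
  pose proof (Rmin_l x (c - x)). pose proof (Rmin_r x (c - x)).
  assert (Hyd : Rabs (y - x) < d1) by lra.
  assert (Hyc : 0 < y < c).
  { assert (Hy1 : Rabs (y - x) < x) by lra. assert (Hy2 : Rabs (y - x) < c - x) by lra.
    apply Rabs_def2 in Hy1. apply Rabs_def2 in Hy2. lra. }
  specialize (K1 y Hyd). apply Rabs_def2 in K1.
  destruct (HP y Hyc) as (Hv & Pv & Py & Ev).
  apply Rlt_trans with (e' + (e - e') / 2); [|lra].
  apply Rle_lt_trans with e'; [|lra]. apply Rabs_le. split.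
  - destruct (Rle_lt_dec (- e') (P y - P x)) as [|H3]; [assumption|].
    pose proof (prim_decr w (P y) (P x - e') Hw Pv ltac:(lra)). lra.
  - destruct (Rle_lt_dec (P y - P x) e') as [|H3]; [assumption|].
    assert (Pp : pos_to w (P x + e')) by (apply pos_to_between with (P x); [lra|exact Pu]).
    pose proof (prim_decr w (P x + e') (P y) Hw Pp ltac:(lra)). lra.
Qed.

(** The trapping argument of [paired_continuity_pt] at the end point [0], where [prim w]
    vanishes. *)
Lemma paired_limit_zero : 0 < c ->
  forall e, 0 < e -> exists d, 0 < d /\ d <= c /\ forall y, 0 < y < d -> - e < P y < 0.
Proof.
  intros Hc e He.
  assert (P0 : pos_to w 0).
  { destruct (HP (c / 2)) as (_ & _ & Pc & _); [lra|].
    apply pos_to_between with (c / 2); [lra|exact Pc]. }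
  destruct (pos_to_open w 0 Hw P0) as [d0 [Hd0 K0]].
  set (e' := Rmin (e / 2) (d0 / 2)).
  assert (He' : 0 < e' /\ e' < e /\ e' < d0).
  { unfold e', Rmin. destruct (Rle_dec (e / 2) (d0 / 2)); lra. }
  assert (Pm : pos_to w (- e')) by (apply K0; rewrite Rabs_left; lra).
  pose proof (prim_decr w (- e') 0 Hw Pm ltac:(lra)) as F1. rewrite prim_zero in F1.
  destruct (continuity_pt_eps (prim w) 0 (prim_continuity_pt 0 P0) _ F1) as [d1 [Hd1 K1]].
  exists (Rmin d1 c). split; [now apply Rmin_pos|]. split; [apply Rmin_r|].
  intros y Hy. pose proof (Rmin_l d1 c). pose proof (Rmin_r d1 c).
  assert (Hyd : Rabs (y - 0) < d1) by (rewrite Rabs_pos_eq; lra).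
  specialize (K1 y Hyd). rewrite prim_zero in K1. apply Rabs_def2 in K1.
  destruct (HP y) as (Hv & Pv & Py & Ev); [lra|]. split; [|exact Hv].
  destruct (Rlt_le_dec (- e') (P y)) as [|[H1|H1]]; [lra| |].
  - pose proof (prim_decr w (P y) (- e') Hw Pv ltac:(lra)). lra.
  - rewrite H1 in Ev. lra.
Qed.

(** Implicit differentiation of [prim w (P y) = prim w y]. With both increments written as slopes,
    [P y - P x] is [y - x] times a quotient of slopes that is continuous at [x]. *)
Lemma paired_derive x : 0 < x < c ->
  is_derive P x ((x / w x) / (P x / w (P x))).
Proof.
  intros Hx. destruct (HP x Hx) as (Hu & Pu & Px & E).
  set (a := x / w x). set (b := P x / w (P x)).
  assert (Hb : b < 0).
  { unfold b. apply Ropp_lt_cancel. rewrite Ropp_0.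
    replace (- (P x / w (P x))) with (- P x / w (P x)) by (unfold Rdiv; ring).
    apply Rdiv_lt_0_compat; [lra|now apply pos_to_end]. }
  set (g := fun y => slope (prim w) x a y / slope (prim w) (P x) b (P y)).
  replace (a / b) with (g x) by (unfold g; now rewrite !slope_at).
  assert (CS : continuity_pt (fun y => slope (prim w) (P x) b (P y)) x).
  { apply (continuity_pt_comp P (slope (prim w) (P x) b)).
    - now apply paired_continuity_pt.
    - apply slope_continuity. now apply is_derive_prim. }
  destruct (continuity_pt_pos (fun y => - slope (prim w) (P x) b (P y)) x) as [d [Hd K]].
  { now apply continuity_pt_opp. }
  { rewrite slope_at. lra. }
  apply is_derive_caratheodory with (Rmin d (Rmin x (c - x))).
  - repeat apply Rmin_pos; lra.
  - apply continuity_pt_div; [|exact CS|rewrite slope_at; lra].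
    apply slope_continuity. now apply is_derive_prim.
  - intros y Hy.
    pose proof (Rmin_l d (Rmin x (c - x))). pose proof (Rmin_r d (Rmin x (c - x))).
    pose proof (Rmin_l x (c - x)). pose proof (Rmin_r x (c - x)).
    assert (Hyc : 0 < y < c).
    { assert (Hy1 : Rabs (y - x) < x) by lra. assert (Hy2 : Rabs (y - x) < c - x) by lra.
      apply Rabs_def2 in Hy1. apply Rabs_def2 in Hy2. lra. }
    destruct (HP y Hyc) as (Hv & Pv & Py & Ev).
    specialize (K y ltac:(lra)).
    pose proof (slope_spec (prim w) x a y) as S1.
    pose proof (slope_spec (prim w) (P x) b (P y)) as S2.
    rewrite Ev, E, S1 in S2. unfold g.
    apply (Rmult_eq_reg_l (slope (prim w) (P x) b (P y))); [|lra].
    rewrite <- S2. field. lra.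
Qed.
End PairedMap.

(** * Derivative and zeros of the slow divergence integral *)

Lemma Xsl_continuity (B ap dp : R) : continuity (Xsl B ap dp).
Proof.
  intros s. apply is_derive_continuity_pt with (ap / (1 + dp)).
  unfold Xsl. auto_derive; [exact I|unfold Rdiv; ring].
Qed.

Section SlowDivergence.
Variables (B ap dp bm gm c : R).
Hypothesis HB : B > dp.
Hypothesis Hdp : dp > 0.
Hypothesis Hgood : forall y, 0 <= y < c -> good B ap dp bm gm y.

Let P := Pi bm gm.
Let w := Wq bm gm.
Let v := Xsl B ap dp.
Let J y := RInt (fun u => u / v u) (P y) y.

Lemma Pi_paired_on y : 0 < y < c -> paired w y (P y).
Proof. intros Hy. apply Pi_paired; [lra|]. apply Hgood. lra. Qed.

Lemma Xsl_pos_to y z : 0 < y < c -> P y <= z <= y -> pos_to v z.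
Proof.
  intros Hy Hz s Hs. destruct (Pi_paired_on y Hy) as (Hu & _).
  destruct (Hgood y ltac:(lra)) as [_ K]. apply K. fold P.
  revert Hs. unfold Rmin, Rmax. destruct (Rle_dec 0 z); lra.
Qed.

Lemma sliding_integral_prim y : 0 < y < c -> J y = prim v y - prim v (P y).
Proof.
  intros Hy. destruct (Pi_paired_on y Hy) as (Hu & _).
  apply RInt_prim; [apply Xsl_continuity| |]; apply Xsl_pos_to with y; lra.
Qed.

(** Up to the factor [1 + dp], this is [w y * v (P y) - w (P y) * v y] divided by [y - P y]. *)
Let G y := (B - dp) * bm * (y + P y) - (B - dp) * gm + ap * bm * (y * P y) - ap.
Let dP y := (y / w y) / (P y / w (P y)).
Let k y := y * (y - P y) / ((1 + dp) * v y * v (P y) * w y).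

Lemma domain_positivity y : 0 < y < c -> P y < 0 /\ 0 < w y /\ 0 < w (P y) /\ 0 < v y /\ 0 < v (P y).
Proof.
  intros Hy. destruct (Pi_paired_on y Hy) as (Hu & Pu & Py & _).
  split; [exact Hu|]. split; [now apply pos_to_end|]. split; [now apply pos_to_end|].
  split; apply pos_to_end; apply Xsl_pos_to with y; lra.
Qed.

Lemma derivative_factor_pos y : 0 < y < c -> 0 < k y.
Proof.
  intros Hy. destruct (domain_positivity y Hy) as (Hu & H1 & H2 & H3 & H4).
  unfold k. apply Rdiv_lt_0_compat; [apply Rmult_lt_0_compat; lra|].
  do 3 (apply Rmult_lt_0_compat; [|assumption]). lra.
Qed.

Lemma Pi_derive y : 0 < y < c -> is_derive P y (dP y).
Proof. intros Hy. apply (paired_derive w P c (Wq_continuity bm gm) Pi_paired_on y Hy). Qed.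

Lemma sliding_integral_derive y : 0 < y < c -> is_derive J y (k y * G y).
Proof.
  intros Hy. destruct (domain_positivity y Hy) as (Hu & H1 & H2 & H3 & H4).
  apply (is_derive_ext_loc (fun y => prim v y - prim v (P y))).
  { assert (Hd : 0 < Rmin y (c - y)) by (apply Rmin_pos; lra).
    exists (mkposreal _ Hd). intros z Hz. symmetry. apply sliding_integral_prim.
    pose proof (Rmin_l y (c - y)). pose proof (Rmin_r y (c - y)).
    unfold ball in Hz; simpl in Hz. unfold AbsRing_ball, abs, minus, plus, opp in Hz; simpl in Hz.
    apply Rabs_def2 in Hz. lra. }
  apply derive_eq with (y / v y - dP y * (P y / v (P y))).
  - apply (is_derive_minus (V := R_NormedModule) (prim v) (fun y => prim v (P y))).
    + apply is_derive_prim; [apply Xsl_continuity|]. apply Xsl_pos_to with y; lra.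
    + apply (is_derive_comp (V := R_NormedModule) (prim v) P); [|now apply Pi_derive].
      apply is_derive_prim; [apply Xsl_continuity|]. apply Xsl_pos_to with y; lra.
  (* The [P y] in the denominator of [dP y] cancels, leaving a numerator antisymmetric in [y] and
     [P y], hence divisible by [y - P y]. *)
  - transitivity (y * (w y * v (P y) - w (P y) * v y) / (v y * v (P y) * w y)).
    + unfold dP. field. lra.
    + replace (w y * v (P y) - w (P y) * v y) with ((y - P y) * G y / (1 + dp)).
      * unfold k. field. lra.
      * unfold G, w, v, Wq, Xsl. field. lra.
Qed.

Let dG y := bm * ((B - dp) * (1 + dP y) + ap * (P y + y * dP y)).

Lemma G_derive y : 0 < y < c -> is_derive G y (dG y).
Proof.
  intros Hy. unfold G. auto_derive.
  - repeat split; exists (dP y); now apply Pi_derive.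
  - rewrite (is_derive_unique (fun x : R => P x) _ _ (Pi_derive y Hy)). unfold dG. ring.
Qed.

(** At a zero of [G] the ratio [w (P y) / w y] inside [dP y] equals [v (P y) / v y]. Thus [w]
    disappears and the sign depends on [bm] and [y + P y] alone. *)
Lemma dG_at_zero y : 0 < y < c -> G y = 0 ->
  dG y = bm * (B - dp + ap * P y) * (y + P y) / P y.
Proof.
  intros Hy HG. destruct (domain_positivity y Hy) as (Hu & H1 & H2 & H3 & H4).
  assert (E : w (P y) * (B - dp + ap * y) = w y * (B - dp + ap * P y)).
  { assert (K : w y * (B - dp + ap * P y) - w (P y) * (B - dp + ap * y) = (y - P y) * G y)
      by (unfold G, w, Wq; ring).
    rewrite HG in K. lra. }
  transitivity (bm * ((B - dp + ap * P y) + y * (w (P y) * (B - dp + ap * y)) / (P y * w y))).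
  - unfold dG, dP. field. lra.
  - rewrite E. field. lra.
Qed.

Lemma G_zero_unique : cond B ap dp bm gm ->
  forall x y, 0 < x < c -> 0 < y < c -> G x = 0 -> G y = 0 -> x = y.
Proof.
  intros Hcond x y Hx Hy Ex Ey.
  destruct (Req_dec bm 0) as [Hb|Hb].
  (* Here [G] is the constant [- (ap + gm * (B - dp))], nonzero by the condition. *)
  - destruct Hcond as [[H _]|[_ H]]; [contradiction|]. exfalso. apply H.
    unfold G in Ex. rewrite Hb in Ex. lra.
  - destruct Hcond as [[_ H]|[H _]]; [|contradiction].
    destruct (Req_dec gm 0) as [Hg|Hg].
    (* For [gm = 0] the half-map is [x -> - x] and [G] reduces to [- ap * w x], without zeros. *)
    + exfalso. destruct (paired_sum_sign bm gm x (P x)) as (_ & _ & S); [lra|now apply Pi_paired_on|].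
      specialize (S Hg). destruct (domain_positivity x Hx) as (_ & H1 & _).
      assert (K : ap * w x = - G x).
      { unfold G, w, Wq. replace (P x) with (- x) by lra. rewrite Hg. ring. }
      rewrite Ex, Ropp_0 in K. apply Rmult_integral in K. lra.
    (* The factor [bm * gm] makes the derivative at zeros positive, since [z + P z] has the sign of
       [- gm]. *)
    + apply (increasing_zero_unique (fun y => bm * gm * G y) (fun y => bm * gm * dG y) c);
        try assumption; try (rewrite ?Ex, ?Ey; ring).
      * intros z Hz. apply (is_derive_scal G). now apply G_derive.
      * intros z Hz Ez.
        assert (HG : G z = 0).
        { apply Rmult_integral in Ez. destruct Ez as [Ez|Ez]; [|exact Ez].
          apply Rmult_integral in Ez. lra. }
        rewrite dG_at_zero by assumption.
        destruct (domain_positivity z Hz) as (Hu & H1 & H2 & H3 & H4).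
        assert (HX : 0 < B - dp + ap * P z).
        { unfold v, Xsl in H4.
          replace (B - dp + ap * P z) with ((B - dp + ap * P z) / (1 + dp) * (1 + dp)) by (field; lra).
          apply Rmult_lt_0_compat; lra. }
        destruct (paired_sum_sign bm gm z (P z)) as (S1 & S2 & _); [lra|now apply Pi_paired_on|].
        assert (S : 0 < gm * - (z + P z)).
        { destruct (Rtotal_order gm 0) as [L|[L|L]]; [|contradiction|].
          - specialize (S2 L). nra.
          - specialize (S1 L). apply Rmult_lt_0_compat; lra. }
        replace (bm * gm * (bm * (B - dp + ap * P z) * (z + P z) / P z)) with
          (bm ^ 2 * (gm * - (z + P z)) * (B - dp + ap * P z) / - P z) by (field; lra).
        apply Rdiv_lt_0_compat; [|lra].
        do 2 (apply Rmult_lt_0_compat; [|assumption]). now apply pow2_gt_0.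
Qed.

Lemma sliding_integral_limit_zero : 0 < c ->
  forall e, 0 < e -> exists d, 0 < d /\ forall x, 0 < x < d -> Rabs (J x) < e.
Proof.
  intros Hc e He.
  assert (P0 : pos_to v 0).
  { destruct (domain_positivity (c / 2)) as (Hu & _); [lra|]. apply Xsl_pos_to with (c / 2); lra. }
  destruct (continuity_pt_eps (prim v) 0
    (prim_continuity_pt v (Xsl_continuity B ap dp) 0 P0) (e / 2)) as [d1 [Hd1 K1]]; [lra|].
  destruct (paired_limit_zero w P c (Wq_continuity bm gm) Pi_paired_on Hc d1 Hd1) as (d2 & Hd2 & Hd2c & K2).
  exists (Rmin d1 d2). split; [now apply Rmin_pos|]. intros x Hx.
  pose proof (Rmin_l d1 d2). pose proof (Rmin_r d1 d2).
  rewrite sliding_integral_prim by lra. specialize (K2 x ltac:(lra)).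
  pose proof (K1 x ltac:(rewrite Rabs_pos_eq; lra)) as A1.
  pose proof (K1 (P x) ltac:(rewrite Rabs_left; lra)) as A2.
  rewrite prim_zero in A1, A2. apply Rabs_def2 in A1. apply Rabs_def2 in A2.
  apply Rabs_def1; lra.
Qed.

(** Rolle between [0] and [x] gives a zero of [G] before [x]; a double zero of [J] at [x] would make
    [x] a second one. *)
Lemma sliding_integral_zero_simple : cond B ap dp bm gm -> forall x, 0 < x < c -> J x = 0 ->
  exists d, is_derive J x d /\ d <> 0.
Proof.
  intros Hcond x Hx Ex. exists (k x * G x). split; [now apply sliding_integral_derive|].
  destruct (rolle_from_zero J (fun y => k y * G y) x) as [z [Hz Ez]]; [lra| | |exact Ex|].
  - intros y Hy. apply sliding_integral_derive. lra.
  - apply sliding_integral_limit_zero. lra.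
  - intros Ek. apply Rmult_integral in Ek. apply Rmult_integral in Ez.
    pose proof (derivative_factor_pos x Hx). pose proof (derivative_factor_pos z ltac:(lra)).
    assert (z = x); [|lra]. apply G_zero_unique; try assumption; lra.
Qed.

(** Two zeros would give [G] one zero in []0, x[] and another in []x, y[]. *)
Lemma sliding_integral_zero_unique : cond B ap dp bm gm -> forall x y, 0 < x -> y < c -> x < y ->
  J x = 0 -> J y = 0 -> False.
Proof.
  intros Hcond x y Hx Hy Hxy Ex Ey.
  destruct (rolle_from_zero J (fun y => k y * G y) x) as [z [Hz Ez]]; [lra| | |exact Ex|].
  - intros u Hu. apply sliding_integral_derive. lra.
  - apply sliding_integral_limit_zero. lra.
  - destruct (mvt_open J (fun y => k y * G y) x y Hxy) as [z' [Hz' Ez']].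
    + intros u Hu. apply sliding_integral_derive. lra.
    + rewrite Ex, Ey in Ez'.
      assert (Ez2 : k z' * G z' = 0).
      { assert (K : k z' * G z' * (y - x) = 0) by lra. apply Rmult_integral in K. lra. }
      apply Rmult_integral in Ez. apply Rmult_integral in Ez2.
      pose proof (derivative_factor_pos z ltac:(lra)). pose proof (derivative_factor_pos z' ltac:(lra)).
      assert (z = z'); [|lra]. apply G_zero_unique; try assumption; lra.
Qed.

Lemma sliding_integral_identically_zero : ~ cond B ap dp bm gm -> forall x, 0 < x < c -> J x = 0.
Proof.
  intros Hcond x Hx. pose proof (Pi_paired_on x Hx) as Hpair.
  destruct (domain_positivity x Hx) as (Hu & _).
  destruct (Req_dec bm 0) as [Hb|Hb].
  - assert (Ha : ap = - gm * (B - dp)).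
    { destruct (Req_dec (ap + gm * (B - dp)) 0); [lra|]. exfalso. apply Hcond. right. tauto. }
    (* [v] is a constant multiple of [w], so [J] is a multiple of the integral that vanishes by the
       definition of [paired]. The identity holds even at zeros of [w], inversion being total. *)
    assert (Ev : forall u, u / v u = (1 + dp) / (B - dp) * (u / w u)).
    { intros u. unfold v, w, Xsl, Wq. rewrite Hb, Ha.
      replace (B - dp + - gm * (B - dp) * u) with ((B - dp) * (1 - gm * u)) by ring.
      replace (0 * u ^ 2 - gm * u + 1) with (1 - gm * u) by ring.
      unfold Rdiv. rewrite !Rinv_mult, Rinv_inv. ring. }
    destruct Hpair as (_ & Pu & Px & E).
    unfold J. rewrite (RInt_ext _ (fun u => (1 + dp) / (B - dp) * (u / w u))) by (intros; apply Ev).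
    rewrite (RInt_scal (V := R_CompleteNormedModule) (fun u => u / w u)).
    + rewrite (RInt_prim w) by (assumption || apply Wq_continuity).
      rewrite E. unfold scal; simpl. unfold mult; simpl. ring.
    + apply ex_RInt_Chasles with 0; [apply ex_RInt_swap|];
        apply ex_RInt_prim; assumption || apply Wq_continuity.
  - assert (Ha : ap = 0).
    { destruct (Req_dec ap 0); [assumption|]. exfalso. apply Hcond. left. tauto. }
    assert (Hg : gm = 0).
    { destruct (Req_dec gm 0); [assumption|]. exfalso. apply Hcond. left. tauto. }
    (* Now [P x = - x] and [v] is constant: an odd integrand over a symmetric interval. *)
    destruct (paired_sum_sign bm gm x (P x)) as (_ & _ & S); [lra|exact Hpair|].
    specialize (S Hg). unfold J. replace (P x) with (- x) by lra.
    apply is_RInt_unique.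
    set (F := fun u => (1 + dp) / (B - dp) * (u ^ 2 / 2)).
    replace 0 with (minus (F x) (F (- x)))
      by (unfold F, minus, plus, opp; simpl; field; lra).
    apply (is_RInt_derive (V := R_CompleteNormedModule) F).
    + intros u _. unfold F, v, Xsl. rewrite Ha. auto_derive; [exact I|field; lra].
    + intros u _. apply continuous_id_div; [apply Xsl_continuity|].
      unfold v, Xsl. rewrite Ha. apply Rdiv_lt_0_compat; lra.
Qed.
End SlowDivergence.

(** * A saddle whose slow divergence integral has a zero *)

(* Eigenvalues [2] and [-1]: the orbit is rational in [exp t], [z] is the value of [exp] at the
   return time, and [D - 1] is a multiple of [(exp t - 1) (A (exp t^2 + exp t + 1) - 1)]. *)
Lemma saddle_half_return (z : R) (A := / (1 + z + z ^ 2)) : 1 < z ->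
  half_return (-2) 1 ((1 - 3 * A) / 2) (- A * z ^ 2 / 2 + (1 - A) / z - 1 / 2).
Proof.
  intros Hz. exists (ln z). split; [rewrite <- ln_1; apply ln_increasing; lra|].
  assert (HA : 0 < A) by (apply Rinv_0_lt_compat; nra).
  assert (EA : A * (1 + z + z ^ 2) = 1) by (unfold A; field; nra).
  clearbody A.
  exists (fun t => - A * exp t ^ 2 / 2 + (1 - A) / exp t - 1 / 2).
  exists (fun t => (A * exp t ^ 2 + (1 - A) / exp t - 1) / 2).
  rewrite exp_0, exp_ln by lra.
  split; [|split; [|split; [|split; [|split; [|split]]]]].
  - intros t. pose proof (exp_pos t). auto_derive; [lra|field; lra].
  - intros t. pose proof (exp_pos t). auto_derive; [lra|field; lra].
  - field.
  - field.
  - intros t Ht.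
    assert (H1 : 1 < exp t) by (rewrite <- exp_0; apply exp_increasing; lra).
    assert (H2 : exp t < z) by (rewrite <- (exp_ln z) by lra; apply exp_increasing; lra).
    generalize dependent (exp t). intros y H1 H2.
    replace ((A * y ^ 2 + (1 - A) / y - 1) / 2) with
      (- ((y - 1) * (1 - A * (1 + y + y ^ 2)) / (2 * y))) by (field; lra).
    apply Ropp_lt_gt_0_contravar. apply Rdiv_lt_0_compat; [|lra].
    apply Rmult_lt_0_compat; [lra|].
    assert (0 < A * (z + z ^ 2 - (y + y ^ 2))); [|lra].
    apply Rmult_lt_0_compat; [exact HA|nra].
  - replace ((A * z ^ 2 + (1 - A) / z - 1) / 2) with
      ((z - 1) * (A * (1 + z + z ^ 2) - 1) / (2 * z)) by (field; lra).
    rewrite EA. field. lra.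
  - reflexivity.
Qed.

Lemma saddle_Pi_dom (x : R) : 0 <= x < 1 / 2 -> Pi_dom (-2) 1 x.
Proof.
  intros Hx. destruct (Req_dec x 0) as [->|Hx0]; [now left|]. right. split; [lra|].
  (* Solves [x = (1 - 3 A) / 2], that is [1 + z + z^2 = 3 / (1 - 2 x)], by [z = (r - 1) / 2];
     [x > 0] makes [r > 3], hence [z > 1]. *)
  set (r := sqrt (12 / (1 - 2 * x) - 3)).
  assert (H12 : 9 < 12 / (1 - 2 * x) - 3).
  { replace (12 / (1 - 2 * x) - 3) with (9 + 24 * x / (1 - 2 * x)) by (field; lra).
    assert (0 < 24 * x / (1 - 2 * x)) by (apply Rdiv_lt_0_compat; lra). lra. }
  assert (Er : r ^ 2 = 12 / (1 - 2 * x) - 3) by (apply pow2_sqrt; lra).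
  assert (Hr : 3 < r).
  { assert (0 <= r) by apply sqrt_pos. nra. }
  pose proof (saddle_half_return ((r - 1) / 2) ltac:(lra)) as K. cbv zeta in K.
  assert (E : 1 + (r - 1) / 2 + ((r - 1) / 2) ^ 2 = 3 / (1 - 2 * x)).
  { replace (1 + (r - 1) / 2 + ((r - 1) / 2) ^ 2) with ((r ^ 2 + 3) / 4) by field.
    rewrite Er. field. lra. }
  rewrite E in K.
  replace ((1 - 3 * / (3 / (1 - 2 * x))) / 2) with x in K by (field; lra).
  eexists. exact K.
Qed.

Lemma saddle_Pi_example : Pi (-2) 1 (2 / 7) = - 5 / 14.
Proof.
  apply Pi_half_return; [lra|].
  (* Return time [ln 2], with [A = 1 / 7]. *)
  pose proof (saddle_half_return 2 ltac:(lra)) as K. cbv zeta in K.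
  replace (/ (1 + 2 + 2 ^ 2)) with (1 / 7) in K by field.
  replace ((1 - 3 * (1 / 7)) / 2) with (2 / 7) in K by field.
  now replace (- (1 / 7) * 2 ^ 2 / 2 + (1 - 1 / 7) / 2 - 1 / 2) with (- 5 / 14) in K by field.
Qed.

(** Needed for [5 / 4 < exp (9 / 40)], where the linear bound [49 / 40] falls short. *)
Lemma exp_quadratic_lt (x : R) : 0 < x -> 1 + x + x ^ 2 / 2 < exp x.
Proof.
  intros Hx.
  pose proof (derive_pos_lt (fun y => exp y - (1 + y + y ^ 2 / 2)) (fun y => exp y - (1 + y)) 0 x Hx)
    as K.
  cbv beta in K. rewrite exp_0 in K.
  enough (1 - (1 + 0 + 0 ^ 2 / 2) < exp x - (1 + x + x ^ 2 / 2)) by lra.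
  apply K.
  - intros y _. auto_derive; [exact I|field].
  - intros y Hy. pose proof (exp_ineq1 y ltac:(lra)). lra.
Qed.

(* With [ap = - 14 a] and [x0 = 4/14], [Pi x0 = - 5/14], this says that the integral vanishes. *)
Lemma example_parameter : exists a, 1 / 20 < a < 1 / 5 /\
  ln (1 + 5 * a) - ln (1 - 4 * a) - 9 * a = 0.
Proof.
  set (f := fun a => ln (1 + 5 * a) - ln (1 - 4 * a) - 9 * a).
  (* [a = 0] is a double root, so the bracket starts to its right, at a point where [1 + 5 a] and
     [1 - 4 a] are reciprocal. *)
  assert (H1 : f (1 / 20) < 0).
  { unfold f. replace (1 + 5 * (1 / 20)) with (5 / 4) by field.
    replace (1 - 4 * (1 / 20)) with (/ (5 / 4)) by field.
    rewrite ln_Rinv by lra.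
    assert (E : ln (5 / 4) + ln (5 / 4) < 9 / 20); [|lra].
    rewrite <- ln_mult by lra. apply exp_lt_inv. rewrite exp_ln by lra.
    replace (9 / 20) with (9 / 40 + 9 / 40) by field. rewrite exp_plus.
    assert (K : 5 / 4 < exp (9 / 40)).
    { pose proof (exp_quadratic_lt (9 / 40) ltac:(lra)). lra. }
    nra. }
  assert (H2 : 0 < f (1 / 5)).
  (* The claim becomes [exp (9 / 5) < 10], which follows from [exp 2 <= 9]. *)
  { unfold f. replace (1 + 5 * (1 / 5)) with 2 by field.
    replace (1 - 4 * (1 / 5)) with (/ 5) by field.
    rewrite ln_Rinv by lra.
    assert (E : 9 / 5 < ln 2 + ln 5); [|lra].
    rewrite <- ln_mult by lra. apply exp_lt_inv. rewrite exp_ln by lra.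
    apply Rlt_trans with (exp (1 + 1)); [apply exp_increasing; lra|].
    rewrite exp_plus. pose proof exp_le_3. pose proof (exp_pos 1). nra. }
  destruct (IVT_interv f (1 / 20) (1 / 5)) as [a [Ha Ea]]; try lra.
  - intros a Ha. apply is_derive_continuity_pt with (5 / (1 + 5 * a) + 4 / (1 - 4 * a) - 9).
    unfold f. auto_derive; [lra|field; lra].
  - exists a. split; [|exact Ea].
    destruct (Req_dec a (1 / 20)) as [->|]; [lra|].
    destruct (Req_dec a (1 / 5)) as [->|]; lra.
Qed.

(** * Passage from the integral to [SDI], and the three claims *)

Lemma SDI_factor_pos (phi : R -> R) (dp : R) : admissible_phi phi -> dp > 0 ->
  0 < (1 + dp) * Derive phi (phi_inv phi (/ (1 + dp))).
Proof. intros (_ & H & _) Hd. apply Rmult_lt_0_compat; [lra|apply H]. Qed.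

Theorem theorem2p5 (phi : R -> R) (Hphi : admissible_phi phi) :
  (* (1) under the condition, at most one zero counting multiplicity in ]0,b[ *)
  (forall B ap bp gp dp bm gm : R, B > dp -> dp > 0 -> cond B ap dp bm gm ->
     (forall x0, 0 < x0 -> in_I_dom B ap dp bm gm x0 ->
        SDI phi B ap dp bm gm x0 = 0 ->
        exists d, is_derive (SDI phi B ap dp bm gm) x0 d /\ d <> 0) /\
     (forall x0 x1, 0 < x0 -> in_I_dom B ap dp bm gm x0 ->
        0 < x1 -> in_I_dom B ap dp bm gm x1 ->
        SDI phi B ap dp bm gm x0 = 0 -> SDI phi B ap dp bm gm x1 = 0 ->
        x0 = x1)) /\
  (* (2) the bound is attained: a simple zero for suitable parameters *)
  (exists bm gm B ap dp : R, B > dp /\ dp > 0 /\ cond B ap dp bm gm /\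
     exists x0 d, 0 < x0 /\ in_I_dom B ap dp bm gm x0 /\
       SDI phi B ap dp bm gm x0 = 0 /\
       is_derive (SDI phi B ap dp bm gm) x0 d /\ d <> 0) /\
  (* (3) otherwise I vanishes identically on [0,b[ *)
  (forall B ap bp gp dp bm gm : R, B > dp -> dp > 0 -> ~ cond B ap dp bm gm ->
     forall x, in_I_dom B ap dp bm gm x -> SDI phi B ap dp bm gm x = 0).
Proof.
  assert (Hzero : forall B ap dp bm gm x, dp > 0 -> SDI phi B ap dp bm gm x = 0 ->
    RInt (fun u => u / Xsl B ap dp u) (Pi bm gm x) x = 0).
  { intros B ap dp bm gm x Hdp E. unfold SDI in E.
    pose proof (SDI_factor_pos phi dp Hphi Hdp).
    apply Rmult_integral in E. destruct E; [lra|assumption]. }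
  (* Shared by the first two claims: in the example, simplicity of the zero follows from the general
     result. *)
  assert (Hsimple : forall B ap dp bm gm : R, B > dp -> dp > 0 -> cond B ap dp bm gm ->
    forall x0, 0 < x0 -> in_I_dom B ap dp bm gm x0 ->
      SDI phi B ap dp bm gm x0 = 0 ->
      exists d, is_derive (SDI phi B ap dp bm gm) x0 d /\ d <> 0).
  { intros B ap dp bm gm HB Hdp Hcond x0 Hx0 (_ & c & Hc & Hgood) E.
    destruct (sliding_integral_zero_simple B ap dp bm gm c Hdp Hgood Hcond x0) as [d [Hd Hne]];
      [lra|now apply Hzero|].
    pose proof (SDI_factor_pos phi dp Hphi Hdp) as HK.
    exists ((1 + dp) * Derive phi (phi_inv phi (/ (1 + dp))) * d). split.
    - apply (is_derive_scal (fun x => RInt (fun u => u / Xsl B ap dp u) (Pi bm gm x) x)).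
      exact Hd.
    - intros E'. apply Rmult_integral in E'. lra. }
  split; [|split].
  - intros B ap _ _ dp bm gm HB Hdp Hcond. split; [now apply Hsimple|].
    intros x0 x1 Hx0 (_ & c0 & Hc0 & Hg0) Hx1 (_ & c1 & Hc1 & Hg1) E0 E1.
    apply Hzero in E0; [|exact Hdp]. apply Hzero in E1; [|exact Hdp].
    destruct (Rtotal_order x0 x1) as [H|[H|H]]; [exfalso|exact H|exfalso].
    (* The interval belonging to the larger zero contains both. *)
    + now apply (sliding_integral_zero_unique B ap dp bm gm c1 Hdp Hg1 Hcond x0 x1).
    + now apply (sliding_integral_zero_unique B ap dp bm gm c0 Hdp Hg0 Hcond x1 x0).
  - destruct example_parameter as [a [Ha Ea]].
    (* [Xsl] is [(1 - 14 a u) / 2], and [a < 1 / 5] puts its zero beyond [5 / 14], to the right of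
       [2 / 7]. *)
    assert (HX : forall u, u < 5 / 14 -> 0 < Xsl 2 (-14 * a) 1 u).
    { intros u Hu. unfold Xsl. apply Rdiv_lt_0_compat; [|lra].
      destruct (Rle_lt_dec u 0); nra. }
    assert (Hcond : cond 2 (-14 * a) 1 (-2) 1) by (left; split; [lra|right; lra]).
    assert (Hdom : in_I_dom 2 (-14 * a) 1 (-2) 1 (2 / 7)).
    { split; [lra|]. exists (5 / 14). split; [lra|]. intros y Hy. split.
      - apply saddle_Pi_dom. lra.
      - intros u Hu. apply HX. lra. }
    assert (E : SDI phi 2 (-14 * a) 1 (-2) 1 (2 / 7) = 0).
    { unfold SDI. rewrite saddle_Pi_example.
      replace (RInt (fun u => u / Xsl 2 (-14 * a) 1 u) (- 5 / 14) (2 / 7)) with 0; [ring|].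
      symmetry. apply is_RInt_unique.
      (* A primitive of [2 u / (1 - 14 a u)]; its increment from [- 5 / 14] to [2 / 7] is zero by
         the equation [Ea]. *)
      set (F := fun u => - 2 * (u / (14 * a) + ln (1 - 14 * a * u) / (14 * a) ^ 2)).
      replace 0 with (minus (F (2 / 7)) (F (- 5 / 14))).
      - apply (is_RInt_derive (V := R_CompleteNormedModule) F).
        + intros u Hu. rewrite Rmin_left, Rmax_right in Hu by lra.
          specialize (HX u ltac:(lra)). unfold Xsl in HX.
          assert (0 < 1 - 14 * a * u) by lra.
          unfold F, Xsl. auto_derive; [repeat split; lra|field; lra].
        + intros u Hu. rewrite Rmin_left, Rmax_right in Hu by lra.
          apply continuous_id_div; [apply Xsl_continuity|apply HX; lra].
      - unfold F, minus, plus, opp; simpl.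
        replace (1 - 14 * a * (2 / 7)) with (1 - 4 * a) by field.
        replace (1 - 14 * a * (-5 / 14)) with (1 + 5 * a) by field.
        replace (ln (1 + 5 * a)) with (ln (1 - 4 * a) + 9 * a) by lra.
        field. lra. }
    exists (-2), 1, 2, (-14 * a), 1. split; [lra|]. split; [lra|]. split; [exact Hcond|].
    destruct (Hsimple 2 (-14 * a) 1 (-2) 1 ltac:(lra) ltac:(lra) Hcond (2 / 7) ltac:(lra) Hdom E)
      as [d [Hd Hne]].
    exists (2 / 7), d. split; [lra|]. tauto.
  - intros B ap _ _ dp bm gm HB Hdp Hcond x (Hx & c & Hc & Hgood). unfold SDI.
    destruct (Req_dec x 0) as [->|Hx0].
    + rewrite Pi_zero, RInt_point. apply Rmult_0_r.
    + rewrite (sliding_integral_identically_zero B ap dp bm gm c HB Hdp Hgood Hcond x) by lra. ring.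
Qed.
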